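(* Let $(P,\omega)$ be a non-empty labeled poset. Then $$e(P,\omega;\lambda)=\lambda\sum_{\emptyset\ne S\in\mathcal I_\omega(P)}(1-\lambda)^{|S|-1}e(P\setminus S,\omega;\lambda)$$ and $$\tilde e(P,\omega;\lambda)=\frac{\lambda}{1-\lambda}\sum_{\emptyset\ne S\in\mathcal I_\omega(P)}\tilde e(P\setminus S,\omega;\lambda).$$
   Context: All posets are finite and $\mathbb N^+=\{1,2,\dots\}$, $[n]=\{1,\dots,n\}$. An ideal of a poset $P$ is a down-closed subset (including $\emptyset$ and $P$). A labeled poset $(P,\omega)$ is a finite poset $P$ with an injective map $\omega:P\to\mathbb N^+$; each subset $S\subseteq P$ carries the induced order and labeling, giving a labeled poset $(S,\omega)$. A subset $S$ is $\omega$-natural if $\omega|_S$ is order-preserving; $\mathcal I_\omega(P)$ is the set of ideals of $P$ that are $\omega$-natural. A map $f:P\to[n]$ is $\omega$-order-preserving if it is order-preserving and $f(x)>f(y)$ whenever $x>y$ in $P$ and $\omega(x)<\omega(y)$. The order polynomial $\Omega(P,\omega;t)$ is the unique polynomial in $t$ whose value at each $n\in\mathbb N^+$ is the number of $\omega$-order-preserving maps $P\to[n]$; $\Omega(\emptyset,\omega;t)=1$. The Eulerian polynomial $e(P,\omega;\lambda)$ and the invariant $\tilde e(P,\omega;\lambda)$ are defined by $$\tilde e(P,\omega;\lambda)=\sum_{n=0}^\infty\Omega(P,\omega;n)\lambda^n=\frac{e(P,\omega;\lambda)}{(1-\lambda)^{|P|+1}} .$$ In particular $e(\emptyset,\omega;\lambda)=1$.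 *)

(* Defs.v *)
From HB Require Import structures.
From mathcomp Require Import all_boot all_order all_algebra.
From mathcomp Require Import boolp classical_sets.
Set Implicit Arguments.
Unset Strict Implicit.
Unset Printing Implicit Defensive.
Import Order.TTheory GRing.Theory.
Local Open Scope ring_scope.

Record fps (R : Type) := FPS { fps_coef : nat -> R }.

Section FormalPowerSeries.
Variable R : comNzRingType.
Implicit Types a b c : fps R.

HB.instance Definition _ := gen_eqMixin (fps R).
HB.instance Definition _ := gen_choiceMixin (fps R).

Lemma fpsP a b : (forall n, fps_coef a n = fps_coef b n) -> a = b.
Proof. by case: a b => [a] [b] /= eq_ab; congr FPS; apply/funext. Qed.

Definition fps_zero : fps R := FPS (fun=> 0).
Definition fps_opp a := FPS (fun n => - fps_coef a n).
Definition fps_add a b := FPS (fun n => fps_coef a n + fps_coef b n).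
Definition fps_one : fps R := FPS (fun n => (n == 0)%:R).
Definition fps_mul a b :=
  FPS (fun n => \sum_(i < n.+1) fps_coef a i * fps_coef b (n - i)).

Lemma fps_addA : associative fps_add.
Proof. by move=> a b c; apply: fpsP => n /=; rewrite addrA. Qed.
Lemma fps_addC : commutative fps_add.
Proof. by move=> a b; apply: fpsP => n /=; rewrite addrC. Qed.
Lemma fps_add0 : left_id fps_zero fps_add.
Proof. by move=> a; apply: fpsP => n /=; rewrite add0r. Qed.
Lemma fps_addN : left_inverse fps_zero fps_opp fps_add.
Proof. by move=> a; apply: fpsP => n /=; rewrite addNr. Qed.

HB.instance Definition _ :=
  GRing.isZmodule.Build (fps R) fps_addA fps_addC fps_add0 fps_addN.

Let trunc n a : {poly R} := \poly_(i < n.+1) fps_coef a i.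

Let coef_trunc n a i : (i <= n)%N -> (trunc n a)`_i = fps_coef a i.
Proof. by move=> le_in; rewrite coef_poly ltnS le_in. Qed.

Let coef_truncM n a b i : (i <= n)%N ->
  (trunc n a * trunc n b)`_i = fps_coef (fps_mul a b) i.
Proof.
move=> le_in; rewrite coefM; apply: eq_bigr => j _.
by rewrite !coef_trunc ?(leq_trans (leq_subr _ _)) // (leq_trans (leq_ord j)).
Qed.

Lemma fps_mulA : associative fps_mul.
Proof.
move=> a b c; apply: fpsP => n.
have -> : fps_coef (fps_mul a (fps_mul b c)) n =
    (trunc n a * (trunc n b * trunc n c))`_n.
  rewrite coefM; apply: eq_bigr => j _.
  by rewrite coef_trunc ?coef_truncM ?leq_subr ?leq_ord.
rewrite mulrA coefM; apply: eq_bigr => j _.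
by rewrite coef_trunc ?coef_truncM ?leq_subr ?leq_ord.
Qed.

Lemma fps_mulC : commutative fps_mul.
Proof. by move=> a b; apply: fpsP => n; rewrite -!(@coef_truncM n) // mulrC. Qed.

Lemma fps_mul1 : left_id fps_one fps_mul.
Proof.
move=> a; apply: fpsP => n /=.
by rewrite big_ord_recl big1 => [|i _] /=; rewrite ?mul1r ?subn0 ?addr0 ?mul0r.
Qed.

Lemma fps_mulDl : left_distributive fps_mul fps_add.
Proof.
move=> a b c; apply: fpsP => n /=; rewrite -big_split /=.
by apply: eq_bigr => i _; rewrite mulrDl.
Qed.

Lemma fps_one_neq0 : fps_one != 0.
Proof.
apply/eqP => /(congr1 (fun a => fps_coef a 0)) /= /eqP.
by rewrite oner_eq0.
Qed.

HB.instance Definition _ := GRing.Zmodule_isComNzRing.Build (fps R)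
  fps_mulA fps_mulC fps_mul1 fps_mulDl fps_one_neq0.

Definition fps_unit : {pred fps R} := fun a => `[< exists b, b * a = 1 >].
Definition fps_inv a : fps R := xget a (fun b => b * a = 1).

Lemma fps_mulV : {in fps_unit, left_inverse 1 fps_inv *%R}.
Proof.
move=> a /asboolP [b ba1]; rewrite /fps_inv.
by case: xgetP => [c _ //|/(_ b)].
Qed.

Lemma fps_unitP a b : b * a = 1 -> fps_unit a.
Proof. by move=> ba1; apply/asboolP; exists b. Qed.

Lemma fps_inv_out : {in [predC fps_unit], fps_inv =1 id}.
Proof.
move=> a /asboolP nu; rewrite /fps_inv; case: xgetP => // b _ ba1.
by case: nu; exists b.
Qed.

HB.instance Definition _ := GRing.ComNzRing_hasMulInverse.Build (fps R)
  fps_mulV fps_unitP fps_inv_out.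

Definition fps_of_poly (p : {poly R}) : fps R := FPS (fun n => p`_n).

Definition fpsX : fps R := fps_of_poly 'X.

Lemma fps_geometric : FPS (fun=> 1) * (1 - fpsX) = 1.
Proof.
rewrite mulrC; apply: fpsP => -[|n].
  rewrite /= big_ord_recl big_ord0 /= mulr1 coefX /=.
  by rewrite subr0 addr0.
rewrite /= !big_ord_recl big1 => [|i _] /=; rewrite ?coefX /=.
  by rewrite !mulr1 subr0 addr0 sub0r subrr.
by rewrite subr0 mul0r.
Qed.

Lemma unit_fps_1subX : 1 - fpsX \is a GRing.unit.
Proof. exact: fps_unitP fps_geometric. Qed.

End FormalPowerSeries.

Section InducedPoset.
Variables (d : Order.disp_t) (P : finPOrderType d) (S : {set P}).

Definition subposet : predArgType := {x : P | x \in S}.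

HB.instance Definition _ := SubFinite.on subposet.
HB.instance Definition _ := [SubChoice_isSubPOrder of subposet by <: with d].

Definition restrict (omega : P -> nat) : subposet -> nat := omega \o val.

End InducedPoset.
Arguments restrict {d P} S omega _.

Section LabeledPoset.
Variables (d : Order.disp_t) (P : finPOrderType d) (omega : P -> nat).

Definition labeling : Prop :=
  injective omega /\ forall x, (0 < omega x)%N.

Definition ideal (S : {set P}) : bool :=
  [forall x in S, forall y, (y <= x)%O ==> (y \in S)].

Definition natural (S : {set P}) : bool :=
  [forall x in S, forall y in S, (x <= y)%O ==> (omega x <= omega y)%N].

Definition natural_ideals : {set {set P}} :=
  [set S | ideal S && natural S].

(* The chain [n] is represented by the ordinals 0 < 1 < ... < n-1. *)
Definition omega_order_preserving n (f : {ffun P -> 'I_n}) : bool :=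
  [forall x, forall y, (x <= y)%O ==> (f x <= f y)%O] &&
  [forall x, forall y, (y < x)%O && (omega x < omega y)%N ==> (f y < f x)%O].

Definition is_order_poly (p : {poly rat}) : Prop :=
  forall n : nat, (0 < n)%N ->
    p.[n%:R] = #|[set f : {ffun P -> 'I_n} | omega_order_preserving f]|%:R.

(* There is exactly one such polynomial, so the default value 0 of xget is
   never used; the same applies to the Eulerian polynomial below. *)
Definition order_poly : {poly rat} := xget 0 is_order_poly.

(* The coefficient at 0 is the value at 0 of the polynomial, not a number of
   maps. *)
Definition eulerian_series : fps rat := FPS (fun n => order_poly.[n%:R]).

Definition is_eulerian_poly (q : {poly rat}) : Prop :=
  eulerian_series = fps_of_poly q / (1 - fpsX rat) ^+ #|P|.+1.

Definition eulerian_poly : {poly rat} := xget 0 is_eulerian_poly.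

End LabeledPoset.

(* Main.v *)
(* Splitting an omega-order-preserving map f : P -> [n+1] along the fibre S of
   the least value gives a natural ideal S and an arbitrary such map
   P \ S -> [n], so Omega(P; n+1) is the sum of Omega(P \ S; n) over S.  The
   term S = empty makes this a formula for the first difference of Omega(P; -);
   summing it by induction on |P| in the basis of binomial coefficients shows
   that the counts are given by a polynomial also at n = 0, where the count
   vanishes for non-empty P.  In generating functions the difference formula is
   the second identity; multiplying it by (1 - X)^|P| gives the first, and
   the existence of the Eulerian polynomial along the way. *)
Require Import Defs.
From mathcomp Require Import all_boot all_order all_algebra.
From HB Require Import structures.
From mathcomp Require boolp classical_sets.
Import GRing.Theory.
Local Open Scope ring_scope.

Set Implicit Arguments.
Unset Strict Implicit.

(** * Polynomials as a subring of the power series *)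

Section PolynomialSeries.
Variable R : comNzRingType.

Lemma fps_of_poly_is_zmod_morphism : zmod_morphism (@fps_of_poly R).
Proof. by move=> p q; apply: fpsP => n; rewrite /= coefB. Qed.

Lemma fps_of_poly_is_monoid_morphism : monoid_morphism (@fps_of_poly R).
Proof.
split=> [|p q]; apply: fpsP => n; first by rewrite /= coef1.
by rewrite /= coefM.
Qed.

HB.instance Definition _ := GRing.isZmodMorphism.Build {poly R} (fps R)
  (@fps_of_poly R) fps_of_poly_is_zmod_morphism.
HB.instance Definition _ := GRing.isMonoidMorphism.Build {poly R} (fps R)
  (@fps_of_poly R) fps_of_poly_is_monoid_morphism.

Lemma fps_of_poly_inj : injective (@fps_of_poly R).
Proof.
move=> p q eq_pq; apply/polyP => n.
exact: (congr1 (fun a => fps_coef a n) eq_pq).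
Qed.

Lemma fps_coef_mulX (a : fps R) n :
  fps_coef (fpsX R * a) n = if n is m.+1 then fps_coef a m else 0.
Proof.
case: n => [|n]; first by rewrite /= big_ord1 coefX mul0r.
rewrite /= !big_ord_recl big1 => [|i _]; rewrite !coefX ?mul0r //=.
by rewrite mul1r add0r addr0 /bump subSS subn0.
Qed.

Lemma fps_coef_sum (I : Type) (r : seq I) (p : pred I) (F : I -> fps R) n :
  fps_coef (\sum_(i <- r | p i) F i) n = \sum_(i <- r | p i) fps_coef (F i) n.
Proof. by elim/big_rec2: _ => //= i _ x _ <-. Qed.

End PolynomialSeries.

(** * Interpolation at integers and the binomial basis *)

Section Interpolation.
Variable R : numFieldType.

Lemma eq_poly_pos_nat (p q : {poly R}) :
  (forall n, (0 < n)%N -> p.[n%:R] = q.[n%:R]) -> p = q.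
Proof.
move=> eq_pq; apply/eqP; rewrite -subr_eq0; apply: contraT => nz.
(* The values agree at positive integers only, hence [i.+1]. These roots are distinct in
   characteristic 0 and one too many for the degree. *)
pose s : seq R := [seq i.+1%:R | i <- iota 0 (size (p - q))].
have /(max_poly_roots nz) : all (root (p - q)) s.
  by apply/allP => _ /mapP[i _ ->]; rewrite rootE !hornerE eq_pq // subrr.
rewrite size_map size_iota ltnn => -> //.
rewrite map_inj_uniq ?iota_uniq // => i j /eqP.
by rewrite Num.Theory.eqr_nat => /eqP[].
Qed.

Lemma bin_poly k : exists p : {poly R}, forall n, p.[n%:R] = 'C(n, k)%:R.
Proof.
elim: k => [|k [p pE]]; first by exists 1 => n; rewrite hornerE bin0.
(* From [(k+1) C(n, k+1) = (n-k) C(n, k)]. *)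
exists (k.+1%:R^-1 *: (p * ('X - k%:R%:P))) => n.
have kS_neq0 : k.+1%:R != 0 :> R by rewrite Num.Theory.pnatr_eq0.
rewrite hornerZ hornerM hornerXsubC pE; apply: (mulfI kS_neq0); rewrite mulVKf //.
rewrite -natrM mul_bin_left natrM mulrC.
have [le_kn|lt_nk] := leqP k n; first by rewrite natrB.
(* Truncated [n - k] differs here from the difference in [R], but the factor [C(n, k)] vanishes. *)
by rewrite bin_small // !mulr0.
Qed.

Lemma sum_bin_poly (c : nat -> R) m :
  exists p : {poly R}, forall n, p.[n%:R] = \sum_(i < m) c i * 'C(n, i)%:R.
Proof.
elim: m => [|m [p pE]]; first by exists 0 => n; rewrite hornerE big_ord0.
have [q qE] := bin_poly m.
by exists (p + c m *: q) => n; rewrite big_ord_recr !hornerE pE qE.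
Qed.

(** By Pascal's rule [C(n, i)] is the first difference of [C(n, i+1)], so summation shifts the
    coefficients up one place and [f 0] becomes the constant term. *)
Lemma sum_bin_of_diff (f : nat -> R) (c : nat -> R) m :
  (forall n, f n.+1 - f n = \sum_(i < m) c i * 'C(n, i)%:R) ->
  exists c' : nat -> R, forall n, f n = \sum_(i < m.+1) c' i * 'C(n, i)%:R.
Proof.
move=> df; exists (fun i => if i is j.+1 then c j else f 0) => n.
rewrite big_ord_recl /= bin0 mulr1.
elim: n => [|n IHn]; first by rewrite big1 ?addr0 // => i _; rewrite mulr0.
rewrite -[f n.+1](subrK (f n)) df IHn addrC -addrA -big_split /=.
by congr (_ + _); apply: eq_bigr => i _; rewrite binS natrD mulrDr.
Qed.

End Interpolation.

(** * Splitting a map along its zero fibre *)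

Section Maps.
Context {d : Order.disp_t} {P : finPOrderType d} (omega : P -> nat).

Definition omega_maps n : {set {ffun P -> 'I_n}} :=
  [set f | omega_order_preserving omega f].

Lemma omega_mapsP n (f : {ffun P -> 'I_n}) :
  reflect ((forall x y, (x <= y)%O -> (f x <= f y)%N) /\
           (forall x y, (y < x)%O -> (omega x < omega y)%N -> (f y < f x)%N))
          (f \in omega_maps n).
Proof.
rewrite inE; apply: (iffP andP) => -[mono strict]; split.
- by move=> x y le_xy; exact: (implyP (forallP (forallP mono x) y)).
- move=> x y lt_yx lt_w.
  by apply: (implyP (forallP (forallP strict x) y)); rewrite lt_yx.
- by apply/'forall_forallP => x y; apply/implyP; exact: mono.
- apply/'forall_forallP => x y; apply/implyP => /andP[]; exact: strict.
Qed.

Lemma idealP (S : {set P}) :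
  reflect (forall x y, x \in S -> (y <= x)%O -> y \in S) (ideal S).
Proof.
apply: (iffP 'forall_in_forallP) => idS x.
  by move=> y Sx; exact/implyP/idS.
by move=> Sx y; apply/implyP; exact: idS.
Qed.

Lemma naturalP (S : {set P}) :
  reflect (forall x y, x \in S -> y \in S -> (x <= y)%O ->
             (omega x <= omega y)%N) (natural omega S).
Proof.
apply: (iffP 'forall_in_'forall_in_implyP) => natS x.
  by move=> y Sx Sy; exact: natS.
by move=> Sx y Sy; exact: natS.
Qed.

Definition zeros {n} (f : {ffun P -> 'I_n.+1}) : {set P} :=
  [set x | f x == ord0].

(** No value lies below 0, and two zeros related in [P] with labels in the wrong order would have to
    take strictly different values. *)
Lemma zeros_natural_ideal n (f : {ffun P -> 'I_n.+1}) :
  f \in omega_maps n.+1 -> zeros f \in natural_ideals omega.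
Proof.
case/omega_mapsP => mono strict; rewrite inE; apply/andP; split.
  apply/idealP => x y; rewrite !inE => /eqP fx0 /mono.
  by rewrite fx0 leqn0.
apply/naturalP => x y; rewrite !inE => /eqP fx0 /eqP fy0 le_xy.
rewrite leqNgt; apply/negP => lt_w.
have lt_xy : (x < y)%O.
  rewrite Order.POrderTheory.lt_neqAle le_xy andbT.
  by apply: contraTneq lt_w => ->; rewrite ltnn.
by have := strict _ _ lt_xy lt_w; rewrite fx0 fy0.
Qed.

(** [lift ord0] raises the values of [g] by one, which frees the value 0 for [S]. *)
Definition extend_zero (S : {set P}) {n} (g : {ffun subposet (~: S) -> 'I_n}) :
    {ffun P -> 'I_n.+1} :=
  [ffun x => if insub x is Some u then lift ord0 (g u) else ord0].

Lemma extend_zero_val (S : {set P}) n (g : {ffun subposet (~: S) -> 'I_n}) u :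
  extend_zero g (val u) = lift ord0 (g u).
Proof. by rewrite ffunE valK. Qed.

Lemma extend_zero_in (S : {set P}) n (g : {ffun subposet (~: S) -> 'I_n}) x :
  x \in S -> extend_zero g x = ord0.
Proof. by move=> Sx; rewrite ffunE insubF // inE Sx. Qed.

Lemma extend_zero_inj (S : {set P}) n : injective (@extend_zero S n).
Proof.
move=> g h /ffunP eq_gh; apply/ffunP => u; apply: (@lift_inj _ ord0).
by rewrite -!extend_zero_val.
Qed.

Lemma compl_subposetP (S : {set P}) x :
  x \in S \/ exists u : subposet (~: S), x = val u.
Proof.
have [|nSx] := boolP (x \in S); first by left.
have Cx : x \in ~: S by rewrite inE.
by right; exists (Sub x Cx).
Qed.

Lemma zeros_extend (S : {set P}) n (g : {ffun subposet (~: S) -> 'I_n}) :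
  zeros (extend_zero g) = S.
Proof.
apply/setP => x; rewrite inE.
have [Sx|[u ->]] := compl_subposetP S x; first by rewrite extend_zero_in ?Sx.
by rewrite extend_zero_val; have := valP u; rewrite inE => /negbTE ->.
Qed.

(** Off [zeros f] the values are nonzero, hence in the image of [lift ord0]; a finite choice
    collects the preimages. *)
Lemma extend_zeros n (f : {ffun P -> 'I_n.+1}) :
  exists g : {ffun subposet (~: zeros f) -> _}, extend_zero g = f.
Proof.
have [u|g gE] := @fin_all_exists (subposet (~: zeros f)) (fun=> 'I_n)
    (fun u j => f (val u) = lift ord0 j).
  have := valP u; rewrite !inE eq_sym => nz.
  by have [j] := unlift_some nz; exists j.
exists (finfun g); apply/ffunP => x.
have [fx0|[u ->]] := compl_subposetP (zeros f) x.
  by rewrite extend_zero_in //; move: fx0; rewrite inE => /eqP.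
by rewrite extend_zero_val ffunE -gE.
Qed.

End Maps.

(** Only pairs meeting [S] need an argument. Inside [S] naturality rules out strict conditions;
    nothing outside the ideal [S] lies below an element of [S]; and a step from [S] upwards out of
    it goes from 0 to a positive value. *)
Lemma extend_zero_omega_map d (P : finPOrderType d) (omega : P -> nat)
    (S : {set P}) n (g : {ffun subposet (~: S) -> 'I_n}) :
  S \in natural_ideals omega ->
  (extend_zero g \in omega_maps omega n.+1) =
    (g \in omega_maps (restrict (~: S) omega) n).
Proof.
rewrite inE => /andP[/idealP idS /naturalP natS].
apply/omega_mapsP/omega_mapsP => -[mono strict]; split.
- move=> u v le_uv; have := mono (val u) (val v) le_uv.
  by rewrite !extend_zero_val.
- move=> u v lt_vu lt_w; have := strict (val u) (val v) lt_vu lt_w.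
  by rewrite !extend_zero_val.
- move=> x y le_xy.
  have [Sx|[u xE]] := compl_subposetP S x; first by rewrite extend_zero_in.
  have [Sy|[v yE]] := compl_subposetP S y.
    by have := valP u; rewrite inE -xE (idS _ _ Sy le_xy).
  rewrite xE yE !extend_zero_val /= /bump !add1n ltnS.
  by apply: mono; move: le_xy; rewrite xE yE.
- move=> x y lt_yx lt_w.
  have [Sx|[u xE]] := compl_subposetP S x.
    have le_yx := Order.POrderTheory.ltW lt_yx.
    by have := natS _ _ (idS _ _ Sx le_yx) Sx le_yx; rewrite leqNgt lt_w.
  have [Sy|[v yE]] := compl_subposetP S y.
    by rewrite extend_zero_in // xE extend_zero_val.
  rewrite xE yE !extend_zero_val /= /bump !add1n ltnS.
  by apply: strict; move: lt_yx lt_w; rewrite xE yE.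
Qed.

(** * Counting maps by their zero fibre *)

Section Count.
Context {d : Order.disp_t} {P : finPOrderType d} (omega : P -> nat).

Lemma card_omega_maps_zeros (S : {set P}) n : S \in natural_ideals omega ->
  #|[set f in omega_maps omega n.+1 | zeros f == S]| =
    #|omega_maps (restrict (~: S) omega) n|.
Proof.
move=> natS; rewrite -(card_imset _ (@extend_zero_inj _ _ S n)).
apply: eq_card => f; rewrite inE; apply/andP/imsetP => [[mf /eqP fS]|[g mg ->]].
  (* The type of [g] depends on [zeros f], so [fS] is rewritten in it as well. *)
  have [g gE] := extend_zeros f; rewrite fS in g gE *.
  by exists g => //; rewrite -extend_zero_omega_map // gE.
by rewrite extend_zero_omega_map // zeros_extend.
Qed.

Lemma card_omega_mapsS n :
  #|omega_maps omega n.+1| =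
    (\sum_(S in natural_ideals omega) #|omega_maps (restrict (~: S) omega) n|)%N.
Proof.
rewrite -sum1_card.
rewrite (partition_big zeros (mem (natural_ideals omega))) /=; last first.
  by move=> f; exact: zeros_natural_ideal.
apply: eq_bigr => S natS; rewrite -card_omega_maps_zeros // -sum1_card.
by apply: eq_bigl => f; rewrite inE.
Qed.

(** The subposet on all of [P] is isomorphic to [P] but is another type; composition with [val]
    carries the maps across. *)
Lemma card_omega_maps_setC0 n :
  #|omega_maps (restrict (~: set0) omega) n| = #|omega_maps omega n|.
Proof.
have C0 (x : P) : x \in ~: set0 by rewrite !inE.
pose r (f : {ffun P -> 'I_n}) := [ffun u : subposet (~: set0) => f (val u)].
have r_inj : injective r.
  move=> f g /ffunP eq_fg; apply/ffunP => x.
  by have := eq_fg (Sub x (C0 x)); rewrite !ffunE.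
rewrite -(card_imset _ r_inj); apply: eq_card => g.
apply/idP/imsetP => [mg|[f /omega_mapsP[mono strict] ->]]; last first.
  by apply/omega_mapsP; split=> u v; rewrite !ffunE;
    [exact: (mono (val u) (val v))
    |exact: (strict (val u) (val v))].
exists [ffun x => g (Sub x (C0 x))].
  move/omega_mapsP: mg => [mono strict].
  by apply/omega_mapsP; split=> x y; rewrite !ffunE;
    [exact: (mono (Sub x (C0 x)) (Sub y (C0 y)))
    |exact: (strict (Sub x (C0 x)) (Sub y (C0 y)))].
apply/ffunP => u; rewrite !ffunE; congr (g _); exact: val_inj.
Qed.

Lemma set0_natural_ideal : set0 \in natural_ideals omega.
Proof.
by rewrite inE; apply/andP; split; [apply/idealP|apply/naturalP]=> x y;
  rewrite inE.
Qed.

Lemma card_omega_maps_diff n :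
  #|omega_maps omega n.+1| = (#|omega_maps omega n| +
    \sum_(S in natural_ideals omega | S != set0)
      #|omega_maps (restrict (~: S) omega) n|)%N.
Proof.
rewrite card_omega_mapsS (bigD1 set0) ?set0_natural_ideal //=.
by rewrite card_omega_maps_setC0.
Qed.

Lemma card_omega_maps0 : (0 < #|P|)%N -> #|omega_maps omega 0| = 0%N.
Proof.
case/card_gt0P => x _; apply: eq_card0 => f.
by have := ltn_ord (f x).
Qed.

Lemma card_subposetC (S : {set P}) : (#|S| + #|subposet (~: S)|)%N = #|P|.
Proof. by rewrite card_sig -(cardsC S). Qed.

End Count.

(** * Polynomiality of the counts, including the value at 0 *)

Lemma card_subposetC_lt d (P : finPOrderType d) (S : {set P}) :
  S != set0 -> (#|subposet (~: S)| < #|P|)%N.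
Proof.
by rewrite -card_gt0 => S_gt0; rewrite -(card_subposetC S) addnC -ltn_subLR ?subnn.
Qed.

(** The induction is on a bound [m] for the cardinality rather than on the cardinality itself: all
    the smaller posets then share the same number of binomials, and their expansions add
    coefficientwise. *)
Lemma card_omega_maps_sum_bin d (P : finPOrderType d) (omega : P -> nat) :
  exists m (c : nat -> rat), forall n,
    #|omega_maps omega n|%:R = \sum_(i < m) c i * 'C(n, i)%:R.
Proof.
suff bounded m : (#|P| <= m)%N -> exists c : nat -> rat, forall n,
    #|omega_maps omega n|%:R = \sum_(i < m.+1) c i * 'C(n, i)%:R.
  by exists #|P|.+1; exact: bounded.
elim: m d P omega => [|m IHm] d P omega le_Pm.
  (* For empty [P] there is no non-empty [S], so the count has difference 0. *)
  apply: (@sum_bin_of_diff rat (fun n => #|omega_maps omega n|%:R)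
    (fun=> 0) 0) => n.
  rewrite card_omega_maps_diff natrD addrC addKr big_ord0 big1 // => S.
  have -> : S = set0.
    by apply/eqP; rewrite -cards_eq0 -leqn0 (leq_trans (max_card _)).
  by rewrite eqxx andbF.
pose rest (S : {set P}) n := #|omega_maps (restrict (~: S) omega) n|.
(* One coefficient sequence is chosen for each [S]; the one at [set0] is a dummy. *)
have [S|c cE] := @fin_all_exists {set P} (fun=> nat -> rat)
    (fun S c => S != set0 -> forall n,
       (rest S n)%:R = \sum_(i < m.+1) c i * 'C(n, i)%:R).
  have [->|S_neq0] := eqVneq S set0; first by exists (fun=> 0).
  have lt_SP := card_subposetC_lt S_neq0.
  have [c cE] := IHm _ _ (restrict (~: S) omega) (leq_trans lt_SP le_Pm).
  by exists c.
apply: (@sum_bin_of_diff rat (fun n => #|omega_maps omega n|%:R)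
  (fun i => \sum_(S in natural_ideals omega | S != set0) c S i)) => n.
rewrite card_omega_maps_diff natrD addrC addKr natr_sum.
under eq_bigr => S /andP[_ S_neq0] do rewrite -/(rest S n) cE //.
by rewrite exchange_big; apply: eq_bigr => i _; rewrite mulr_suml.
Qed.

(** The defining property covers [n > 0] only. The binomial expansion also gives the count at 0, and
    uniqueness identifies it with [order_poly]. *)
Lemma horner_order_poly d (P : finPOrderType d) (omega : P -> nat) n :
  (order_poly omega).[n%:R] = #|omega_maps omega n|%:R.
Proof.
have [m [c cE]] := card_omega_maps_sum_bin omega.
have [p pE] := sum_bin_poly c m.
have pP : is_order_poly omega p by move=> k _; rewrite pE -cE.
suff -> : order_poly omega = p by rewrite pE -cE.
apply: eq_poly_pos_nat => k k_gt0; rewrite pP //.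
rewrite /order_poly; case: classical_sets.xgetP => [q _ -> //|/(_ p)].
by case.
Qed.

(** * Generating functions *)

Section Series.
Context {d : Order.disp_t} {P : finPOrderType d} (omega : P -> nat).

Lemma eulerian_series_rec : (0 < #|P|)%N ->
  (1 - fpsX rat) * eulerian_series omega =
    fpsX rat * \sum_(S in natural_ideals omega | S != set0)
      eulerian_series (restrict (~: S) omega).
Proof.
move=> P_gt0; apply/eqP; rewrite mulrBl mul1r subr_eq addrC -mulrDr.
apply/eqP/fpsP => n; rewrite fps_coef_mulX; case: n => [|n].
  (* A non-empty [P] has no map to the empty chain, so the constant term is 0. *)
  by rewrite [LHS]horner_order_poly card_omega_maps0.
rewrite [LHS]horner_order_poly card_omega_maps_diff natrD natr_sum.
rewrite [RHS]/= horner_order_poly fps_coef_sum.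
by congr (_ + _); apply: eq_bigr => S _; rewrite [RHS]horner_order_poly.
Qed.

(** The empty poset has exactly one map for every [n], also for [n = 0], which gives the geometric
    series. *)
Lemma eulerian_series_empty : #|P| = 0%N ->
  eulerian_series omega * (1 - fpsX rat) = 1.
Proof.
move=> P0; rewrite -[RHS]fps_geometric; congr (_ * _); apply: fpsP => n.
rewrite [LHS]horner_order_poly.
have all_maps f : f \in omega_maps omega n.
  by apply/omega_mapsP; split=> x; have := card0_eq P0 x; rewrite !inE.
by rewrite (eq_card all_maps) card_ffun P0 expn0.
Qed.

Lemma is_eulerian_polyE q : is_eulerian_poly omega q <->
  eulerian_series omega * (1 - fpsX rat) ^+ #|P|.+1 = fps_of_poly q.
Proof.
have unit_pow : (1 - fpsX rat) ^+ #|P|.+1 \is a GRing.unit.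
  exact/unitrX/unit_fps_1subX.
by rewrite /is_eulerian_poly; split=> [->|<-]; rewrite ?mulrK ?divrK.
Qed.

End Series.

(** * Existence and recursion of Eulerian polynomials *)

Section EulerianRecursion.
Context {d : Order.disp_t} {P : finPOrderType d} (omega : P -> nat).

(** Stated for any family [q] of witnesses, so that it serves both the inductive existence proof and
    the final identity. *)
Lemma is_eulerian_poly_rec (q : {set P} -> {poly rat}) : (0 < #|P|)%N ->
  (forall S, S != set0 -> is_eulerian_poly (restrict (~: S) omega) (q S)) ->
  is_eulerian_poly omega
    ('X * \sum_(S in natural_ideals omega | S != set0)
            (1 - 'X) ^+ (#|S| - 1) * q S).
Proof.
move=> P_gt0 qP; apply/is_eulerian_polyE.
rewrite exprS mulrA [_ * (1 - _)]mulrC eulerian_series_rec // -mulrA rmorphM.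
congr (_ * _); rewrite rmorph_sum mulr_suml.
apply: eq_bigr => S /andP[_ S_neq0].
rewrite rmorphM rmorphXn rmorphB rmorph1.
rewrite /= -/(fpsX rat) -(iffLR (is_eulerian_polyE _ _) (qP S S_neq0)).
rewrite mulrCA -exprD; congr (_ * _ ^+ _).
(* With one factor [1 - X] spent on the series recursion, the exponents match:
   [|P| = (|S| - 1) + (|P \ S| + 1)], as [S] is non-empty. *)
by rewrite -(card_subposetC S) addnS -addSn subn1 prednK // card_gt0.
Qed.

Lemma is_eulerian_poly_inj p q :
  is_eulerian_poly omega p -> is_eulerian_poly omega q -> p = q.
Proof.
by move=> /is_eulerian_polyE pP /is_eulerian_polyE qP;
  apply: fps_of_poly_inj; rewrite -pP -qP.
Qed.

End EulerianRecursion.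

Lemma eulerian_polyP d (P : finPOrderType d) (omega : P -> nat) :
  is_eulerian_poly omega (eulerian_poly omega).
Proof.
have : exists q, is_eulerian_poly omega q.
  have [m] := ubnP #|P|; elim: m d P omega => // m IHm d P omega lt_Pm.
  have [P0|P_gt0] := posnP #|P|.
    exists 1; apply/is_eulerian_polyE.
    by rewrite P0 expr1 eulerian_series_empty // rmorph1.
  have [S|q qP] := @fin_all_exists {set P} (fun=> {poly rat})
      (fun S q => S != set0 -> is_eulerian_poly (restrict (~: S) omega) q).
    (* The value at [set0] is a dummy that the recursion never reads. *)
    have [->|S_neq0] := eqVneq S set0; first by exists 0.
    have [|q qP] := IHm _ _ (restrict (~: S) omega); last by exists q.
    exact: leq_trans (card_subposetC_lt S_neq0) lt_Pm.
  by eexists; exact: is_eulerian_poly_rec qP.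
case=> q qP; rewrite /eulerian_poly.
by case: classical_sets.xgetP => [p _ //|/(_ q)].
Qed.

Unset Implicit Arguments.

Theorem theorem2p17 (d : Order.disp_t) (P : finPOrderType d)
    (omega : P -> nat) (omegaP : labeling omega) (P_neq0 : (0 < #|P|)%N) :
  eulerian_poly omega =
    'X * \sum_(S in natural_ideals omega | S != set0)
           (1 - 'X) ^+ (#|S| - 1) * eulerian_poly (restrict (~: S) omega)
  /\
  eulerian_series omega =
    fpsX rat / (1 - fpsX rat) *
      \sum_(S in natural_ideals omega | S != set0)
         eulerian_series (restrict (~: S) omega).
Proof.
split.
  (* Both sides are Eulerian polynomials of the same series, hence equal. *)
  apply: is_eulerian_poly_inj (eulerian_polyP omega) _.
  by apply: is_eulerian_poly_rec => // S _; exact: eulerian_polyP.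
(* Multiplication by the unit [1 - X] turns the claim into the series recursion. *)
apply: (mulrI (unit_fps_1subX rat)).
by rewrite eulerian_series_rec // mulrA mulrCA mulrA mulrK ?unit_fps_1subX.
Qed.
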